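(* Let $0<\varepsilon\le1$ and let $\mathfrak{L}_1$ be the linear span of $\{x e^{-\alpha x^2/(2\sqrt\varepsilon)} : \alpha\in(0,1)\}$. Then $\mathfrak{L}_1\subset D(S^{*}_\varepsilon)$, every point of $i(0,\infty)$ is an eigenvalue of $t^*$, and every point of $-i(0,\infty)$ is an eigenvalue of $S^*_\varepsilon$. In particular, $t^*$ and $S^*_\varepsilon$ are unbounded.
   Context: Work in $L^2(\mathbb{R})$ with inner product $(f,g)=\int\overline{f}g\,dx$. Let $q$ be multiplication by $x$ (self-adjoint, injective) and $p=-i\,d/dx$ (self-adjoint). Define $t=q^{-1}p$ with $D(t)=\{f\in D(p): pf\in D(q^{-1})\}$; $t$ is densely defined and $t^*$ denotes its Hilbert-space adjoint. Let $L^2_1$ denote the subspace of odd functions in $L^2(\mathbb{R})$. For $0<\varepsilon\le1$, the operator denoted $S^*_\varepsilon$ (this is notation only; it is not defined as the adjoint of another operator) is the operator in $L^2_1$ given by $D(S^*_\varepsilon)=\{f\in L^2_1\cap\bigcap_{n\ge0}D((t^* )^{2n+1}) : \lim_{N\to\infty}\sum_{n=0}^N\frac{(-1)^n}{2n+1}(\sqrt\varepsilon\,t^* )^{2n+1}f\text{ exists in norm}\}$, $S^*_\varepsilon f=-\frac{1}{\sqrt\varepsilon}\sum_{n=0}^\infty\frac{(-1)^n}{2n+1}(\sqrt\varepsilon\,t^* )^{2n+1}f$. *)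

(* Defs.v *)
From HB Require Import structures.
From mathcomp Require Import all_boot all_order all_algebra.
From mathcomp Require Import all_classical all_reals all_analysis.
From mathcomp Require Import complex.
Set Implicit Arguments. Unset Strict Implicit. Unset Printing Implicit Defensive.
Import Order.TTheory GRing.Theory Num.Theory.
Import numFieldNormedType.Exports.
Local Open Scope classical_set_scope.
Local Open Scope ring_scope.
Local Open Scope complex_scope.

Section Defs.
Variable R : realType.
Local Notation C := (complex R).
Local Notation mu := (@lebesgue_measure R).

Definition cmeas (f : R -> C) : Prop :=
  measurable_fun setT (fun x => complex.Re (f x)) /\
  measurable_fun setT (fun x => complex.Im (f x)).

Definition sqmod (f : R -> C) (x : R) : R :=
  complex.Re (f x) ^+ 2 + complex.Im (f x) ^+ 2.

Definition L2 (f : R -> C) : Prop :=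
  cmeas f /\ (\int[mu]_x (sqmod f x)%:E < +oo)%E.

Definition norm2 (f : R -> C) : R := Num.sqrt (fine (\int[mu]_x (sqmod f x)%:E)).

Definition cint (A : set R) (h : R -> C) : C :=
  Complex (Rintegral mu A (fun x => complex.Re (h x)))
          (Rintegral mu A (fun x => complex.Im (h x))).

Definition inner (f g : R -> C) : C := cint setT (fun x => (f x)^* * g x).

Definition aeeq (f g : R -> C) : Prop := {ae mu, forall x, f x = g x}.

(* g is the (distributional = classical a.e.) derivative of f, f in H^1(R):
   f has a locally absolutely continuous representative F with F' = g *)
Definition hasderiv (f g : R -> C) : Prop :=
  L2 f /\ L2 g /\ exists F : R -> C, aeeq F f /\
    forall a b : R, a <= b -> F b - F a = cint `[a, b] g.

Definition p_rel (f h : R -> C) : Prop :=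
  exists g, hasderiv f g /\ h = (fun x => - 'i * g x).

Definition t_rel (f k : R -> C) : Prop :=
  exists h, p_rel f h /\ L2 (fun x => h x / x%:C) /\ k = (fun x => h x / x%:C).

(* graph of the Hilbert-space adjoint t^* (defined up to a.e. equality) *)
Definition tstar_rel (f h : R -> C) : Prop :=
  L2 f /\ L2 h /\ forall g k, t_rel g k -> inner k f = inner g h.

Fixpoint tstar_pow (n : nat) (f h : R -> C) : Prop :=
  match n with
  | O => L2 f /\ aeeq h f
  | S m => exists g, tstar_pow m f g /\ tstar_rel g h
  end.

Definition L2odd (f : R -> C) : Prop :=
  L2 f /\ aeeq (fun x => f (- x)) (fun x => - f x).

Definition Sstar_rel (eps : R) (f k : R -> C) : Prop :=
  L2odd f /\
  exists (u : nat -> R -> C) (s : R -> C),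
    (forall n, tstar_pow (2 * n).+1 f (u n)) /\ L2 s /\
    (fun N : nat => norm2 (fun x =>
        \sum_(n < N.+1) ((- 1) ^+ n / (2 * n).+1%:R * Num.sqrt eps ^+ (2 * n).+1)%:C
                         * u n x - s x)) @ \oo --> (0 : R) /\
    k = (fun x => - ((Num.sqrt eps)^-1)%:C * s x).

Definition Sstar_dom (eps : R) (f : R -> C) : Prop := exists k, Sstar_rel eps f k.

Definition gauss_gen (eps alpha : R) (x : R) : C :=
  (x * expR (- (alpha * x ^+ 2) / (2 * Num.sqrt eps)))%:C.

End Defs.

(* Main.v *)
Require Import Defs.
From HB Require Import structures.
From mathcomp Require Import all_boot all_order all_algebra.
From mathcomp Require Import all_classical all_reals all_analysis.
From mathcomp Require Import measurable_realfun.
From mathcomp Require Import complex ring lra.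
Set Implicit Arguments. Unset Strict Implicit. Unset Printing Implicit Defensive.
Import Order.TTheory GRing.Theory Num.Theory.
Import numFieldNormedType.Exports.
Local Open Scope classical_set_scope.
Local Open Scope ring_scope.
Local Open Scope complex_scope.

(* For s > 0 the function x exp(- s x^2 / 2) satisfies t^* f = i s f: against an
   absolutely continuous g this is the identity int g' G = - int g G' for the
   Gaussian G(x) = exp(- s x^2 / 2), i.e. integration by parts on the whole line.
   With s = alpha / sqrt eps the series defining S^*_eps acts on this eigenvector
   through sum (-1)^n (i alpha)^(2n+1) / (2n+1) = i artanh alpha, which converges
   exactly because alpha < 1, and artanh maps (0,1) onto (0,oo). Unboundedness
   follows since the eigenvalues are unbounded. *)

(** * Gaussians and integration by parts *)

Section Gaussian.
Variable R : realType.
Local Notation mu := (@lebesgue_measure R).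
Implicit Types (s x y : R).

Definition gaussian s x : R := expR (- (s * x ^+ 2) / 2).

Lemma gaussian_gt0 s x : 0 < gaussian s x.
Proof. exact: expR_gt0. Qed.

Lemma gaussianN s x : gaussian s (- x) = gaussian s x.
Proof. by rewrite /gaussian sqrrN. Qed.

Lemma is_derive_gaussian s x :
  is_derive x 1 (gaussian s) (- (s * x * gaussian s x)).
Proof.
rewrite /gaussian; apply: is_derive_eq.
by rewrite /GRing.scale /=; field.
Qed.

Lemma continuous_gaussian s : continuous (gaussian s).
Proof.
move=> x; apply/differentiable_continuous/derivable1_diffP.
have h := is_derive_gaussian s x; exact: ex_derive.
Qed.

Lemma measurable_gaussian s : measurable_fun setT (gaussian s).
Proof. by apply: continuous_measurable_fun; exact: continuous_gaussian. Qed.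

(** Up to the constant [normal_peak], this is the normal density with mean 0 and standard deviation
    [1 / sqrt s]. *)
Lemma integrable_gaussian s : 0 < s ->
  mu.-integrable setT (EFin \o gaussian s).
Proof.
move=> s0; have rs : Num.sqrt s != 0 by rewrite gt_eqF// sqrtr_gt0.
have := integrable_normal_pdf (0 : R) (Num.sqrt s)^-1.
move=> /(integrableZl measurableT (normal_peak (Num.sqrt s)^-1)^-1).
apply: eq_integrable => // x _; rewrite /= -EFinM; congr (_%:E).
rewrite normal_pdfE ?invr_eq0// mulrA mulVf ?mul1r; last first.
  by rewrite gt_eqF// normal_peak_gt0// invr_eq0.
rewrite /normal_fun /gaussian subr0 exprVn sqr_sqrtr ?ltW//.
congr expR; field; lra.
Qed.

(** Half of the exponent is spent on absorbing [x ^+ 2]: the inequality [z <= expR z] is used at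
    [z = s * x ^+ 2 / 4]. The remaining Gaussian is an integrable majorant. *)
Lemma sqr_gaussian_le s x : 0 < s ->
  x ^+ 2 * gaussian s x <= 4 / s * gaussian (s / 2) x.
Proof.
move=> s0.
have -> : gaussian s x = gaussian (s / 2) x * expR (- (s * x ^+ 2 / 4)).
  by rewrite /gaussian -expRD; congr expR; field.
rewrite mulrCA mulrC ler_wpM2r ?expR_ge0//.
rewrite expRN ler_pdivrMr ?expR_gt0//.
apply: (@le_trans _ _ (4 / s * (s * x ^+ 2 / 4))).
  by rewrite le_eqVlt; apply/orP; left; apply/eqP; field; lra.
rewrite ler_wpM2l ?divr_ge0 ?(ltW s0)//.
by apply: le_trans (expR_ge1Dx _); rewrite lerDr.
Qed.

Lemma integrable_sqr_gaussian s : 0 < s ->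
  mu.-integrable setT (fun x => (x ^+ 2 * gaussian s x)%:E).
Proof.
move=> s0; have s20 : 0 < s / 2 by lra.
apply: le_integrable (integrableZl measurableT (4 / s) (integrable_gaussian s20)).
- by [].
- apply/measurable_EFinP/measurable_funM; first exact: measurable_funX.
  exact: measurable_gaussian.
move=> x _ /=; rewrite lee_fin ger0_norm; last first.
  by rewrite mulr_ge0 ?sqr_ge0 ?expR_ge0.
by apply: le_trans (ler_norm _); exact: sqr_gaussian_le.
Qed.

(** Domination by the two preceding integrable functions, since [|x| <= 1 + x ^+ 2]. *)
Lemma integrable_mul_gaussian s : 0 < s ->
  mu.-integrable setT (fun x => (x * gaussian s x)%:E).
Proof.
move=> s0; have := integrableD measurableT (integrable_gaussian s0)
                      (integrable_sqr_gaussian s0).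
apply: le_integrable => //.
- by apply/measurable_EFinP/measurable_funM => //; exact: measurable_gaussian.
move=> x _ /=; have g0 := ltW (gaussian_gt0 s x).
rewrite lee_fin normrM (ger0_norm g0); apply: le_trans (ler_norm _).
rewrite -[X in _ <= X + _]mul1r -mulrDl ler_wpM2r//.
rewrite -(real_normK (num_real x)); have := normr_ge0 x; nra.
Qed.

Lemma cvg_gaussian s : 0 < s -> gaussian s x @[x --> +oo] --> (0 : R).
Proof.
move=> s0; rewrite (_ : gaussian s = (fun y => expR (- y)) \o
    (fun x => s / 2 * x ^+ 2)); last first.
  by apply/funext => x; rewrite /gaussian /=; congr expR; field.
have h : s / 2 * x ^+ 2 @[x --> +oo] --> +oo.
  by apply: gt0_cvgMry; [lra|exact: cvgr_expr2].
exact: (cvg_comp _ _ h (@cvgr_expR R)).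
Qed.

(** Fundamental theorem of calculus on a half-line: [- gaussian s] is an antiderivative that tends
    to 0 at infinity, and [0 <= x] keeps the integrand nonnegative. *)
Lemma integral_gaussian_tail s x : 0 < s -> 0 <= x ->
  (\int[mu]_(y in `[x, +oo[) (s * y * gaussian s y)%:E = (gaussian s x)%:E)%E.
Proof.
move=> s0 x0.
have dG y : is_derive y 1 (fun z => - gaussian s z) (s * y * gaussian s y).
  by have ? := is_derive_gaussian s y; apply: is_derive_eq; rewrite opprK.
rewrite (@ge0_continuous_FTC2y R _ (fun z => - gaussian s z) x 0).
- by rewrite EFinN oppeK add0e.
- by move=> y xy; rewrite !mulr_ge0 ?expR_ge0 ?(ltW s0) ?(le_trans x0).
- apply: continuous_subspaceT => y.
  apply: cvgM; last exact: continuous_gaussian.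
  by apply: cvgM; [exact: cvg_cst|exact: cvg_id].
- by rewrite -oppr0; apply: cvgN; exact: cvg_gaussian.
- by move=> y _; have h := dG y; exact: ex_derive.
- by apply: cvg_at_right_filter; apply: cvgN; exact: continuous_gaussian.
- by move=> y _; rewrite derive1E; have h := dG y; exact: derive_val.
Qed.


Lemma integral_gaussian_left_tail s x : 0 < s -> x <= 0 ->
  (\int[mu]_(y in `]-oo, x]) (s * - y * gaussian s y)%:E = (gaussian s x)%:E)%E.
Proof.
move=> s0 x0; rewrite -gaussianN -integral_gaussian_tail ?oppr_ge0//.
rewrite -{1}(opprK x).
rewrite (@ge0_integration_by_substitutionNy R (fun y => s * - y * gaussian s y)).
- by apply: eq_integral => y _; rewrite /= opprK gaussianN.
- apply: continuous_subspaceT => y.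
  apply: cvgM; last exact: continuous_gaussian.
  by apply: cvgM; [exact: cvg_cst|apply: cvgN; exact: cvg_id].
- move=> y; rewrite in_itv/= opprK => yx.
  by rewrite !mulr_ge0 ?expR_ge0 ?(ltW s0)// oppr_ge0 (le_trans (ltW yx)).
Qed.

(** The integrand is odd. Its positive and negative parts are the two tails from 0, each with the
    finite integral [gaussian s 0 = 1], so the difference is well defined and vanishes. *)
Lemma integral_mul_gaussian s : 0 < s ->
  (\int[mu]_y (s * y * gaussian s y)%:E = 0)%E.
Proof.
move=> s0; rewrite integralE.
have -> : (\int[mu]_y ((fun y => (s * y * gaussian s y)%:E)^\+ y) = 1)%E.
  transitivity (\int[mu]_(y in `[0%R, +oo[) (s * y * gaussian s y)%:E)%E.
    rewrite [RHS]integral_mkcond; apply: eq_integral => y _.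
    rewrite /= funeposE patchE mem_setE in_itv/= andbT; case: ifPn => y0.
      by rewrite max_l// lee_fin !mulr_ge0 ?expR_ge0// ltW.
    rewrite max_r// lee_fin mulr_le0_ge0 ?expR_ge0//.
    by rewrite pmulr_rle0// ltW// ltNge.
  by rewrite integral_gaussian_tail// /gaussian expr0n/= mulr0 oppr0 mul0r expR0.
have -> : (\int[mu]_y ((fun y => (s * y * gaussian s y)%:E)^\- y) = 1)%E.
  transitivity (\int[mu]_(y in `]-oo, 0%R]) (s * - y * gaussian s y)%:E)%E.
    rewrite [RHS]integral_mkcond; apply: eq_integral => y _.
    rewrite /= funenegE patchE mem_setE in_itv/=; case: ifPn => y0.
      rewrite max_l -?EFinN ?mulrN ?mulNr// lee_fin oppr_ge0.
      by rewrite mulr_le0_ge0 ?expR_ge0// pmulr_rle0.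
    rewrite max_r// lee_fin oppr_le0 !mulr_ge0 ?expR_ge0 ?(ltW s0)//.
    by rewrite ltW// ltNge.
  by rewrite integral_gaussian_left_tail// /gaussian expr0n/= mulr0 oppr0 mul0r expR0.
by rewrite subee.
Qed.

(** The density of the Gaussian tail lying beyond [x] on the side away from the origin. With this
    choice of side the kernel is nonnegative, its integral in [y] is [gaussian s x] for either sign
    of [x], and for fixed [y] it is supported on the bounded interval between 0 and [y]. *)
Definition kern s x y : R :=
  if (if 0 <= x then x <= y else y <= x) then s * `|y| * gaussian s y else 0.

Lemma kern_ge0 s x y : 0 < s -> 0 <= kern s x y.
Proof.
by move=> /ltW s0; rewrite /kern; case: ifP => // _; rewrite !mulr_ge0 ?expR_ge0.
Qed.

Lemma measurable_kern s : measurable_fun setT (fun z : R * R => kern s z.1 z.2).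
Proof.
apply: measurable_fun_ifT => //.
  apply: measurable_fun_ifT => //; exact: measurable_fun_ler.
apply: measurable_funM; last exact: measurableT_comp (measurable_gaussian s) _.
by apply: measurable_funM => //; exact: measurableT_comp.
Qed.

Lemma integral_kern s x : 0 < s ->
  (\int[mu]_y (kern s x y)%:E = (gaussian s x)%:E)%E.
Proof.
move=> s0; have [x0|x0] := leP 0 x.
  rewrite -integral_gaussian_tail// [RHS]integral_mkcond; apply: eq_integral => y _.
  rewrite /kern x0 patchE mem_setE in_itv/= andbT; case: ifPn => // xy.
  by rewrite ger0_norm// (le_trans x0).
rewrite -integral_gaussian_left_tail ?(ltW x0)// [RHS]integral_mkcond.
apply: eq_integral => y _.
rewrite /kern leNgt x0/= patchE mem_setE in_itv/=; case: ifPn => // yx.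
by rewrite ler0_norm// (le_trans yx)// ltW.
Qed.

Lemma integrable_kern s x : 0 < s -> mu.-integrable setT (fun y => (kern s x y)%:E).
Proof.
move=> s0; have mk : measurable_fun setT (fun y => (kern s x y)%:E).
  apply/measurable_EFinP.
  exact: measurableT_comp (measurable_kern s) (measurable_pair1 _).
apply/integrableP; split => //.
under eq_integral do rewrite gee0_abs ?lee_fin ?kern_ge0//.
by rewrite integral_kern// ltry.
Qed.

(** Real counterpart of [L2], to be applied to real and imaginary parts; see [L2P]. *)
Definition sqint (f : R -> R) : Prop :=
  measurable_fun setT f /\ mu.-integrable setT (fun x => (f x ^+ 2)%:E).

Lemma sqint_mul f g : sqint f -> sqint g ->
  mu.-integrable setT (fun x => (f x * g x)%:E).
Proof.
move=> [mf f2] [mg g2]; apply: le_integrable (integrableD measurableT f2 g2) => //.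
  exact/measurable_EFinP/measurable_funM.
move=> x _; rewrite /= lee_fin; apply: le_trans (ler_norm _).
by rewrite ler_norml; apply/andP; split; nra.
Qed.

(** On a bounded interval the constant 1 is integrable, and [|f| <= 1 + f ^+ 2]. *)
Lemma sqint_locally f (a b : R) : sqint f ->
  mu.-integrable `[a, b] (EFin \o f).
Proof.
move=> [mf f2].
have i1 : mu.-integrable `[a, b] (EFin \o cst (1 : R)).
  apply: continuous_compact_integrable; first exact: segment_compact.
  by apply: continuous_subspaceT => x; exact: cvg_cst.
have f2' : mu.-integrable `[a, b] (fun x => (f x ^+ 2)%:E).
  exact: integrableS f2.
apply: le_integrable (integrableD _ i1 f2') => //.
  by apply/measurable_EFinP; apply: measurable_funTS.
move=> x _; rewrite /= lee_fin; apply: le_trans (ler_norm _).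
by rewrite ler_norml; apply/andP; split; nra.
Qed.

Lemma sqint_gaussian s : 0 < s -> sqint (gaussian s).
Proof.
move=> s0; split; first exact: measurable_gaussian.
apply: eq_integrable (integrable_gaussian (s := 2 * s) _) => //; last by lra.
by move=> x _; rewrite /= /gaussian -expRM_natl; congr (expR _)%:E; field.
Qed.

Lemma sqint_mul_gaussian s : 0 < s -> sqint (fun x => x * gaussian s x).
Proof.
move=> s0; split.
  by apply: measurable_funM => //; exact: measurable_gaussian.
apply: eq_integrable (integrable_sqr_gaussian (s := 2 * s) _) => //; last by lra.
move=> x _; rewrite /= exprMn; congr (_ * _)%:E.
by rewrite /gaussian -expRM_natl; congr (expR _); field.
Qed.

(** For fixed [y] the kernel is constant in [x] on the interval between 0 and [y], and zero
    elsewhere, so only the integral of [v] over that interval remains. When [y < 0], the sign in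
    [|y| = - y] matches the reversed increment [U 0 - U y]. *)
Lemma kern_section s (v U : R -> R) y : sqint v ->
  (forall a b, a <= b -> U b - U a = \int[mu]_(x in `[a, b]) v x) ->
  (\int[mu]_x (v x * kern s x y)%:E =
   ((U y - U 0) * (s * y * gaussian s y))%:E)%E.
Proof.
move=> vL UE.
have intZ (a b c : R) :
    (\int[mu]_(x in `[a, b]) (c * v x)%:E = (c * \int[mu]_(x in `[a, b]) v x)%:E)%E.
  under eq_integral do rewrite EFinM.
  have vi := sqint_locally a b vL.
  by rewrite integralZl// EFinM /Rintegral fineK// integrable_fin_num.
have [y0|y0] := leP 0 y.
  transitivity (\int[mu]_(x in `[0%R, y]) (s * y * gaussian s y * v x)%:E)%E.
    rewrite [RHS]integral_mkcond; apply: eq_integral => x _.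
    rewrite /kern patchE mem_setE in_itv/=; have [x0|x0] := leP 0 x => /=.
      by case: ifP => _; rewrite ?mulr0// ger0_norm// mulrC.
    by rewrite leNgt (lt_le_trans x0 y0) mulr0.
  by rewrite intZ UE// mulrC.
transitivity (\int[mu]_(x in `[y, 0%R[) (s * - y * gaussian s y * v x)%:E)%E.
  rewrite [RHS]integral_mkcond; apply: eq_integral => x _.
  rewrite /kern patchE mem_setE in_itv/= andbC; have [x0|x0] := leP 0 x => /=.
    by rewrite leNgt (lt_le_trans y0 x0) mulr0.
  by case: ifP => _; rewrite ?mulr0// ltr0_norm// mulrC.
(* The point [x = 0] falls in the branch [0 <= x] of the kernel, hence the half-open interval;
   adding this endpoint does not change the integral. *)
rewrite integral_itv_bndo_bndc; last first.
  apply/measurable_EFinP; apply: measurable_funM => //.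
  by apply: measurable_funTS; case: vL.
by rewrite intZ -UE ?ltW//; congr EFin; ring.
Qed.

(* Integration by parts against a Gaussian: writing the Gaussian as
   [\int kern s x y dy] and exchanging integrals turns [v] into the increments
   [U y - U 0], and the constant [U 0] is annihilated by the odd weight. *)
Lemma gaussian_by_parts s (u v U : R -> R) : 0 < s -> sqint u -> sqint v ->
  {ae mu, forall x, U x = u x} ->
  (forall a b, a <= b -> U b - U a = \int[mu]_(x in `[a, b]) v x) ->
  \int[mu]_x (v x * gaussian s x) = \int[mu]_x (u x * (s * x * gaussian s x)).
Proof.
move=> s0 uL vL Uu UE; rewrite /Rintegral; congr fine.
pose f (z : R * R) := (v z.1 * kern s z.1 z.2)%:E.
have mf : measurable_fun setT f.
  apply/measurable_EFinP; apply: measurable_funM; last exact: measurable_kern.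
  by apply: measurableT_comp => //; case: vL.
(* Integrating [|f|] in [y] first leaves [|v x| * gaussian s x], a product of two square-integrable
   functions. *)
have intf : (mu \x mu)%E.-integrable setT f.
  apply/integrable12ltyP => //.
  under eq_integral => x _.
    rewrite /f /=; under eq_integral => y _.
      rewrite normrM (ger0_norm (kern_ge0 _ _ s0)) EFinM; over.
    rewrite integralZl//; last exact: integrable_kern.
    rewrite integral_kern// -EFinM -(ger0_norm (ltW (gaussian_gt0 s x))) -normrM; over.
  have /integrableP[_] := sqint_mul vL (sqint_gaussian s0).
  by [].
have mG := measurable_fubini_G intf.
transitivity (\int[mu]_x \int[mu]_y f (x, y))%E.
  apply: eq_integral => x _; rewrite /f /=; under [RHS]eq_integral do rewrite EFinM.
  by rewrite integralZl ?integral_kern//; exact: integrable_kern.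
rewrite (Fubini intf).
have uH := sqint_mul uL (sqint_mul_gaussian s0).
have iH := integrable_mul_gaussian s0.
transitivity (\int[mu]_y (((u y - U 0) * (s * y * gaussian s y))%:E))%E.
  apply: ae_eq_integral => //.
    apply/measurable_EFinP; apply: measurable_funM.
      by apply: measurable_funB => //; case: uL.
    apply: measurable_funM; last exact: measurable_gaussian.
    exact: measurable_funM.
  case: Uu => N [mN N0 UuN]; exists N; split => // y /= fy; apply: UuN => /= Uy.
  apply: fy => _.
  by rewrite /f /= (kern_section _ _ vL UE) Uy.
transitivity (\int[mu]_y ((s%:E * (u y * (y * gaussian s y))%:E) -
    ((U 0 * s)%:E * (y * gaussian s y)%:E)))%E.
  by apply: eq_integral => y _; rewrite -!EFinM -EFinB; congr EFin; ring.
rewrite integralB//; [|exact: integrableZl|exact: integrableZl].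
rewrite [X in (_ - X)%E](_ : _ = 0)%E ?sube0; last first.
  rewrite integralZl//.
  (* The vanishing integral carries the factor [s], which is nonzero and can be divided out. *)
  have : (\int[mu]_y (s%:E * (y * gaussian s y)%:E) = 0)%E.
    rewrite -[RHS](integral_mul_gaussian s0); apply: eq_integral => y _.
    by rewrite -EFinM mulrA.
  rewrite integralZl// => /eqP; rewrite mule_eq0 eqe gt_eqF//= => /eqP ->.
  by rewrite mule0.
by apply: eq_integral => y _; rewrite -EFinM; congr EFin; ring.
Qed.

End Gaussian.

(** * Eigenvectors of the adjoint *)

Section ComplexL2.
Variable R : realType.
Local Notation C := (complex R).
Local Notation mu := (@lebesgue_measure R).
Local Notation Re := (@complex.Re R).
Local Notation Im := (@complex.Im R).
Implicit Types (f g h k : R -> C) (c : C).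

Lemma ReD (a b : C) : Re (a + b) = Re a + Re b. Proof. by case: a; case: b. Qed.
Lemma ImD (a b : C) : Im (a + b) = Im a + Im b. Proof. by case: a; case: b. Qed.
Lemma ReM (a b : C) : Re (a * b) = Re a * Re b - Im a * Im b.
Proof. by case: a; case: b. Qed.
Lemma ImM (a b : C) : Im (a * b) = Re a * Im b + Im a * Re b.
Proof. by case: a; case: b. Qed.
Lemma ReJ (a : C) : Re a^* = Re a. Proof. by case: a. Qed.
Lemma ImJ (a : C) : Im a^* = - Im a. Proof. by case: a. Qed.
Definition reimE := (ReD, ImD, ReM, ImM, ReJ, ImJ).

Lemma complexP (a b : C) : Re a = Re b -> Im a = Im b -> a = b.
Proof. by case: a => ? ?; case: b => ? ? /= -> ->. Qed.

Lemma measurable_sqmod f : cmeas f -> measurable_fun setT (sqmod f).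
Proof. by move=> [? ?]; apply: measurable_funD; apply: measurable_funX. Qed.

Lemma sqmod_ge0 f x : 0 <= sqmod f x.
Proof. by rewrite addr_ge0 ?sqr_ge0. Qed.

Lemma L2_sqmod f : L2 f -> mu.-integrable setT (fun x => (sqmod f x)%:E).
Proof.
move=> [mf ff]; apply/integrableP; split.
  by apply/measurable_EFinP; exact: measurable_sqmod.
by under eq_integral do rewrite gee0_abs ?lee_fin ?sqmod_ge0//.
Qed.

Lemma L2P f : L2 f <-> sqint (Re \o f) /\ sqint (Im \o f).
Proof.
split=> [fL|[[mr ir] [mi ii]]].
  have fi := L2_sqmod fL; case: fL => -[mr mi] _.
  split; split => //; apply: le_integrable fi => //;
    try (exact/measurable_EFinP/measurable_funX);
    move=> x _; rewrite /= lee_fin !ger0_norm ?sqr_ge0 ?sqmod_ge0//.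
    by rewrite /sqmod lerDl sqr_ge0.
  by rewrite /sqmod lerDr sqr_ge0.
split; first by [].
have /integrableP[_] := integrableD measurableT ir ii.
under eq_integral do rewrite -EFinD gee0_abs ?lee_fin ?addr_ge0 ?sqr_ge0//.
by [].
Qed.

Lemma sqintZ (a : R) (v : R -> R) : sqint v -> sqint (fun x => a * v x).
Proof.
move=> [mv iv]; split; first exact: measurable_funM.
apply: eq_integrable (integrableZl measurableT (a ^+ 2) iv) => // x _.
by rewrite -EFinM exprMn.
Qed.

(** Twice the sum of the squares exceeds the square of the sum by [(v x - w x) ^+ 2]. *)
Lemma sqintD (v w : R -> R) : sqint v -> sqint w -> sqint (fun x => v x + w x).
Proof.
move=> [mv iv] [mw iw]; split; first exact: measurable_funD.
apply: le_integrable (integrableD measurableT (integrableZl measurableT 2 iv)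
   (integrableZl measurableT 2 iw)) => //.
  exact/measurable_EFinP/measurable_funX/measurable_funD.
move=> x _; rewrite /= lee_fin; apply: le_trans (ler_norm _).
rewrite ger0_norm ?sqr_ge0// -subr_ge0.
by rewrite (_ : _ - _ = (v x - w x) ^+ 2) ?sqr_ge0//; ring.
Qed.

Lemma L2D f g : L2 f -> L2 g -> L2 (fun x => f x + g x).
Proof.
move=> /L2P[fr fi] /L2P[gr gi]; apply/L2P; split.
  rewrite (_ : _ \o _ = fun x => Re (f x) + Re (g x)); first exact: sqintD.
  by apply/funext => x; rewrite /= reimE.
rewrite (_ : _ \o _ = fun x => Im (f x) + Im (g x)); first exact: sqintD.
by apply/funext => x; rewrite /= reimE.
Qed.

Lemma L2Z c f : L2 f -> L2 (fun x => c * f x).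
Proof.
move=> /L2P[fr fi]; apply/L2P; split.
  rewrite (_ : _ \o _ = fun x => Re c * Re (f x) + - Im c * Im (f x)).
    by apply: sqintD; exact: sqintZ.
  by apply/funext => x; rewrite /= reimE mulNr.
rewrite (_ : _ \o _ = fun x => Re c * Im (f x) + Im c * Re (f x)).
  by apply: sqintD; exact: sqintZ.
by apply/funext => x; rewrite /= reimE.
Qed.

Lemma L2_0 : L2 (fun=> 0 : C).
Proof.
have s0 : sqint (fun=> 0 : R).
  by split => //; under eq_fun do rewrite expr0n; exact: integrable0.
by apply/L2P; split.
Qed.

Lemma L2_sum n (f : 'I_n -> R -> C) : (forall i, L2 (f i)) ->
  L2 (fun x => \sum_(i < n) f i x).
Proof.
elim: n f => [|n IHn] f fL.
  by under eq_fun do rewrite big_ord0; exact: L2_0.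
under eq_fun do rewrite big_ord_recl.
by apply: L2D; [exact: fL|apply: IHn => i; exact: fL].
Qed.

Definition cintegrable (h : R -> C) : Prop :=
  mu.-integrable setT (fun x => (Re (h x))%:E) /\
  mu.-integrable setT (fun x => (Im (h x))%:E).

Lemma cintegrable_inner f g : L2 f -> L2 g ->
  cintegrable (fun x => (f x)^* * g x).
Proof.
move=> /L2P[fr fi] /L2P[gr gi]; split.
  have := integrableD measurableT (sqint_mul fr gr) (sqint_mul fi gi).
  apply: eq_integrable => // x _.
  by rewrite -EFinD /= !reimE; congr EFin; ring.
have := integrableB measurableT (sqint_mul fr gi) (sqint_mul fi gr).
apply: eq_integrable => // x _.
by rewrite -EFinB /= !reimE; congr EFin; ring.
Qed.

Lemma innerD g f h : L2 g -> L2 f -> L2 h ->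
  inner g (fun x => f x + h x) = inner g f + inner g h.
Proof.
move=> gL fL hL.
have [fr fi] := cintegrable_inner gL fL; have [hr hi] := cintegrable_inner gL hL.
apply: complexP; rewrite reimE /= -RintegralD//; apply: eq_Rintegral => x _;
  by rewrite !reimE; ring.
Qed.

Lemma innerZ g f c : L2 g -> L2 f -> inner g (fun x => c * f x) = c * inner g f.
Proof.
move=> gL fL; have [fr fi] := cintegrable_inner gL fL.
apply: complexP; rewrite reimE /=.
  rewrite -(RintegralZl (Re c) measurableT fr) -(RintegralZl (Im c) measurableT fi).
  rewrite -RintegralB//; [|exact: (integrableZl _ _ fr)|exact: (integrableZl _ _ fi)].
  by apply: eq_Rintegral => x _; rewrite !reimE; ring.
rewrite -(RintegralZl (Re c) measurableT fi) -(RintegralZl (Im c) measurableT fr).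
rewrite -RintegralD//; [|exact: (integrableZl _ _ fi)|exact: (integrableZl _ _ fr)].
by apply: eq_Rintegral => x _; rewrite !reimE; ring.
Qed.

Lemma t_rel_L2 g k : t_rel g k -> L2 g /\ L2 k.
Proof. by case=> h [[g' [[gL _] _]] [kL ->]]. Qed.

(** The graph of the adjoint is a linear subspace because [inner] is linear in its second argument.
    This and the next two lemmas carry the eigenvector relation over to finite combinations. *)
Lemma tstar_relD f f' h h' : tstar_rel f h -> tstar_rel f' h' ->
  tstar_rel (fun x => f x + f' x) (fun x => h x + h' x).
Proof.
move=> [fL [hL fh]] [fL' [hL' fh']]; split; first exact: L2D.
split; first exact: L2D.
move=> g k gk; have [gL kL] := t_rel_L2 gk.
by rewrite !innerD// (fh _ _ gk) (fh' _ _ gk).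
Qed.

Lemma tstar_relZ c f h : tstar_rel f h ->
  tstar_rel (fun x => c * f x) (fun x => c * h x).
Proof.
move=> [fL [hL fh]]; split; first exact: L2Z.
split; first exact: L2Z.
move=> g k gk; have [gL kL] := t_rel_L2 gk.
by rewrite !innerZ// (fh _ _ gk).
Qed.

Lemma tstar_rel_sum n (f h : 'I_n -> R -> C) : (forall i, tstar_rel (f i) (h i)) ->
  tstar_rel (fun x => \sum_(i < n) f i x) (fun x => \sum_(i < n) h i x).
Proof.
elim: n f h => [|n IHn] f h fh; last first.
  under eq_fun do rewrite big_ord_recl.
  under [X in tstar_rel _ X]eq_fun do rewrite big_ord_recl.
  by apply: tstar_relD; [exact: fh|apply: IHn => i; exact: fh].
under eq_fun do rewrite big_ord0; under [X in tstar_rel _ X]eq_fun do rewrite big_ord0.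
split; first exact: L2_0.
split; first exact: L2_0.
move=> g k _; apply: complexP => /=; apply: eq_Rintegral => x _;
  by rewrite !mulr0.
Qed.

(** The generator [gauss_gen eps alpha] in the parameter [s = alpha / sqrt eps], for which the
    eigenvalue of the adjoint is simply [i s]; see [gauss_genE]. *)
Definition xgauss (s : R) (x : R) : C := (x * gaussian s x)%:C.

Lemma L2_xgauss s : 0 < s -> L2 (xgauss s).
Proof.
move=> s0; apply/L2P; split; first exact: sqint_mul_gaussian.
have s00 : sqint (fun=> 0 : R).
  by split => //; under eq_fun do rewrite expr0n; exact: integrable0.
exact: s00.
Qed.

(** Serves to cancel [x] against the [1 / x] of [t_rel]: this fails only at the origin, where
    division by zero returns 0, and a single point is null. *)
Lemma Rintegral_eq_off0 (v w : R -> R) : measurable_fun setT v ->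
  measurable_fun setT w -> (forall x, x != 0 -> v x = w x) ->
  \int[mu]_x v x = \int[mu]_x w x.
Proof.
move=> mv mw vw; rewrite /Rintegral; congr fine; apply: ae_eq_integral => //;
  try exact/measurable_EFinP.
exists [set 0]; split => //; first exact: lebesgue_measure_set1.
move=> x /= vwx; apply/eqP; apply: contrapT => /negP x0; apply: vwx => _.
by rewrite vw.
Qed.

Lemma divcE c (x : R) : c / x%:C = Complex (Re c / x) (Im c / x).
Proof.
rewrite -fmorphV; apply: complexP; rewrite !reimE /=.
  by rewrite mulr0 subr0.
by rewrite mulr0 add0r.
Qed.

(** For [k = - i g' / x] the factor [x] of [xgauss] cancels the denominator, so [inner k (xgauss s)]
    is [i] times the integral of the conjugate of [g'] against the Gaussian. Integration by parts
    then produces [s * x * gaussian s x]. *)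
Lemma tstar_xgauss s : 0 < s ->
  tstar_rel (xgauss s) (fun x => (s%:C * 'i) * xgauss s x).
Proof.
move=> s0; have xL := L2_xgauss s0; split => //; split; first exact: L2Z.
move=> g k [h [[g' [[gL [gL' [F [Fg FE]]]] ->]] [kL ->]]].
have /L2P[gr gi] := gL; have /L2P[gr' gi'] := gL'.
have mG := measurable_gaussian s.
have [mr mi] := cintegrable_inner kL xL.
have /measurable_EFinP mr' := measurable_int _ mr.
have /measurable_EFinP mi' := measurable_int _ mi.
have ReF : forall a b, a <= b -> Re (F b) - Re (F a) = \int[mu]_(x in `[a, b]) Re (g' x).
  by move=> a b /FE/(congr1 Re) /= <-; case: (F b); case: (F a).
have ImF : forall a b, a <= b -> Im (F b) - Im (F a) = \int[mu]_(x in `[a, b]) Im (g' x).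
  by move=> a b /FE/(congr1 Im) /= <-; case: (F b); case: (F a).
have aeR : {ae mu, forall x, Re (F x) = Re (g x)}.
  case: Fg => N [mN N0 FN]; exists N; split => // x /= Fx; apply: FN => /= E.
  by apply: Fx; rewrite E.
have aeI : {ae mu, forall x, Im (F x) = Im (g x)}.
  case: Fg => N [mN N0 FN]; exists N; split => // x /= Fx; apply: FN => /= E.
  by apply: Fx; rewrite E.
apply: complexP => /=.
  (* Multiplying the conjugate of [g'] by [i] exchanges the two parts: the real part involves
     [Im g'], and the imaginary part below involves [Re g']. *)
  transitivity (\int[mu]_x (Im (g' x) * gaussian s x)).
    apply: Rintegral_eq_off0 => //.
      by apply: measurable_funM => //; case: gi'.
    by move=> x x0; rewrite divcE !reimE /=; field.
  rewrite (gaussian_by_parts s0 gi gi' aeI ImF).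
  by apply: eq_Rintegral => x _; rewrite !reimE /=; ring.
transitivity (\int[mu]_x (Re (g' x) * gaussian s x)).
  apply: Rintegral_eq_off0 => //.
    by apply: measurable_funM => //; case: gr'.
  by move=> x x0; rewrite divcE !reimE /=; field.
rewrite (gaussian_by_parts s0 gr gr' aeR ReF).
by apply: eq_Rintegral => x _; rewrite !reimE /=; ring.
Qed.

End ComplexL2.

(** * The artanh series *)

Section Artanh.
Variable R : realType.
Implicit Types (a x y : R) (N : nat).

Definition artanh_sum N a : R := \sum_(n < N.+1) a ^+ (2 * n).+1 / (2 * n).+1%:R.

Lemma is_derive_artanh_sum N x :
  is_derive x 1 (artanh_sum N) (\sum_(n < N.+1) x ^+ (2 * n)).
Proof.
have dX n : is_derive x 1 (fun y : R => y ^+ (2 * n).+1 / (2 * n).+1%:R) (x ^+ (2 * n)).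
  rewrite (_ : (fun _ => _) = (2 * n).+1%:R^-1 \*: (@id R ^+ (2 * n).+1)).
    have h := is_derive_id x (1 : R); apply: is_derive_eq.
    by rewrite /GRing.scale /=; field; rewrite -natrM nat1r pnatr_eq0.
  by apply/funext => y; rewrite /= fctE /GRing.scale /= mulrC.
elim: N => [|N IHN].
  rewrite (_ : artanh_sum 0 = fun y : R => y ^+ (2 * 0).+1 / (2 * 0).+1%:R).
    by rewrite big_ord1; exact: dX.
  by apply/funext => y; rewrite /artanh_sum big_ord1.
rewrite (_ : artanh_sum N.+1 =
    artanh_sum N + (fun y : R => y ^+ (2 * N.+1).+1 / (2 * N.+1).+1%:R)).
  by rewrite big_ord_recr; have h := dX N.+1; exact: is_deriveD.
by apply/funext => y; rewrite /artanh_sum big_ord_recr.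
Qed.

(** Geometric sum in [x ^+ 2]. It compares the derivative of the partial sum with
    [1 / (1 - x ^+ 2)], the derivative of artanh. *)
Lemma geometric_even N x :
  (1 - x ^+ 2) * \sum_(n < N.+1) x ^+ (2 * n) = 1 - x ^+ (2 * N.+1).
Proof.
rewrite -[X in X - x ^+ 2](expr1n _ N.+1) exprM -opprB -[RHS]opprB subrX1 mulNr.
congr (- (_ * _)); first by rewrite expr1n.
by apply: eq_bigr => n _; rewrite exprM.
Qed.

(** The logarithmic expression is artanh. *)
Lemma is_derive_artanh x : 0 <= x < 1 ->
  is_derive x 1 (fun y : R => (ln (1 + y) - ln (1 - y)) / 2) (1 - x ^+ 2)^-1.
Proof.
move=> /andP[x0 x1].
have p1 : 0 < 1 + x by lra.
have p2 : 0 < 1 - x by lra.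
have d1 : is_derive x 1 (fun y : R => ln (1 + y)) (1 + x)^-1.
  have h := is_derive1_ln p1.
  by apply: is_derive_eq; rewrite /GRing.scale /=; ring.
have d2 : is_derive x 1 (fun y : R => ln (1 - y)) (- (1 - x)^-1).
  have h := is_derive1_ln p2.
  by apply: is_derive_eq; rewrite /GRing.scale /=; ring.
by apply: is_derive_eq; rewrite /GRing.scale /=; field; nra.
Qed.

(* The N-th remainder vanishes at 0 and has derivative x^(2N+2) / (1 - x^2), so
   the mean value theorem bounds it by a^(2N+2) up to a constant. *)
Lemma cvg_artanh_sum a : 0 < a < 1 ->
  artanh_sum ^~ a @ \oo --> (ln (1 + a) - ln (1 - a)) / 2.
Proof.
move=> /andP[a0 a1].
pose D N y := (ln (1 + y) - ln (1 - y)) / 2 - artanh_sum N y.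
have a2 : 0 < 1 - a ^+ 2 by nra.
have dD N x : 0 <= x < 1 -> is_derive x 1 (D N) (x ^+ (2 * N.+1) / (1 - x ^+ 2)).
  move=> x01; have h1 := is_derive_artanh x01; have h2 := is_derive_artanh_sum N x.
  apply: is_derive_eq; have := geometric_even N x.
  have x2 : 1 - x ^+ 2 != 0 by move: x01 => /andP[? ?]; apply/eqP; nra.
  move=> E; apply: (mulfI x2); rewrite mulrBr E; field.
  by [].
have bound N : 0 <= D N a <= a / (1 - a ^+ 2) * (a ^+ 2) ^+ N.+1.
  have dDa x : x \in `]0, a[%R ->
      is_derive x 1 (D N) (x ^+ (2 * N.+1) / (1 - x ^+ 2)).
    by rewrite in_itv/= => /andP[x0 xa]; apply: dD; rewrite (ltW x0) (lt_trans xa).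
  have cD : {within `[0, a], continuous (D N)}.
    apply: derivable_within_continuous => x; rewrite in_itv/= => /andP[x0 xa].
    have h : is_derive x 1 (D N) (x ^+ (2 * N.+1) / (1 - x ^+ 2)).
      by apply: dD; rewrite x0 (le_lt_trans xa).
    exact: ex_derive.
  have [c] := MVT_segment (ltW a0) dDa cD.
  rewrite in_itv/= => /andP[c0 ca].
  have -> : D N 0 = 0.
    rewrite /D addr0 subr0 subrr mul0r sub0r /artanh_sum big1 ?oppr0// => i _.
    by rewrite expr0n/= mul0r.
  rewrite !subr0 => ->.
  have c2 : 0 < 1 - c ^+ 2 by nra.
  apply/andP; split; first by rewrite mulr_ge0 ?divr_ge0 ?exprn_ge0// ltW.
  (* Since [0 < c < a < 1], replacing [c] by [a] increases both the power and the reciprocal of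
     [1 - c ^+ 2]. *)
  rewrite exprM [leRHS]mulrC mulrA -[leRHS]mulrAC ler_wpM2r ?(ltW a0)//.
  rewrite ler_pM// ?exprn_ge0 ?sqr_ge0 ?invr_ge0 ?(ltW c2)//.
    by rewrite lerXn2r ?nnegrE ?sqr_ge0// lerXn2r ?nnegrE ?(ltW a0).
  by rewrite lef_pV2 ?posrE//; nra.
have B0 : (fun N => a / (1 - a ^+ 2) * (a ^+ 2) ^+ N.+1) @ \oo --> (0 : R).
  have a21 : `|a ^+ 2| < 1 by rewrite ger0_norm ?sqr_ge0//; nra.
  have h : (fun N => (a ^+ 2) ^+ N.+1) @ \oo --> (0 : R).
    by rewrite (cvg_shiftS (fun N => (a ^+ 2) ^+ N)); exact: cvg_expr.
  by rewrite -(mulr0 (a / (1 - a ^+ 2))); apply: cvgM; [exact: cvg_cst|].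
have D0 : D ^~ a @ \oo --> (0 : R).
  by apply: (squeeze_cvgr _ (cvg_cst 0) B0); apply: nearW => N; exact: bound.
rewrite (_ : artanh_sum ^~ a = fun N => (ln (1 + a) - ln (1 - a)) / 2 - D N a).
  by rewrite -[X in _ --> X]subr0; apply: cvgB => //; exact: cvg_cst.
by apply/funext => N; rewrite /D opprB addrC subrK.
Qed.

(** The witness is tanh of [y], written with [e = expR (2 * y)]. Both [1 + a] and [1 - a] contain
    the factor [2 / (e + 1)], so the difference of logarithms is [ln e = 2 * y]. *)
Lemma artanh_surj y : 0 < y ->
  exists2 a : R, 0 < a < 1 & (ln (1 + a) - ln (1 - a)) / 2 = y.
Proof.
move=> y0; have e1 : 1 < expR (2 * y) by rewrite expR_gt1; lra.
set e := expR _ in e1.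
exists ((e - 1) / (e + 1)).
  by apply/andP; split; [apply: divr_gt0; lra|rewrite ltr_pdivrMr; lra].
have -> : 1 + (e - 1) / (e + 1) = e * (2 / (e + 1)) by field; lra.
have -> : 1 - (e - 1) / (e + 1) = 2 / (e + 1) by field; lra.
have p : 0 < 2 / (e + 1) by apply: divr_gt0; lra.
by rewrite lnM ?posrE// ?addrK; [rewrite expRK; field|lra].
Qed.

End Artanh.

(** * Norms and the action of the series *)

Section Norm.
Variable R : realType.
Local Notation C := (complex R).
Local Notation mu := (@lebesgue_measure R).
Local Notation Re := (@complex.Re R).
Local Notation Im := (@complex.Im R).
Implicit Types (f g : R -> C) (c : C) (s : R).

(** Convergence is estimated on squared norms, where pointwise inequalities suffice; continuity of
    the square root transfers it to [norm2] in [Sstar_sum]. *)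
Definition normsq f : R := \int[mu]_x sqmod f x.
Definition sqabs c : R := Re c ^+ 2 + Im c ^+ 2.

Lemma norm2E f : norm2 f = Num.sqrt (normsq f). Proof. by []. Qed.

Lemma normsq_ge0 f : 0 <= normsq f.
Proof. by apply: Rintegral_ge0 => x _; exact: sqmod_ge0. Qed.

Lemma normsqZ c f : L2 f -> normsq (fun x => c * f x) = sqabs c * normsq f.
Proof.
move=> /L2_sqmod fi; rewrite /normsq -RintegralZl//.
by apply: eq_Rintegral => x _; rewrite /sqmod /sqabs !reimE; ring.
Qed.

Lemma norm2Z c f : L2 f -> norm2 (fun x => c * f x) = Num.sqrt (sqabs c) * norm2 f.
Proof. by move=> fL; rewrite !norm2E normsqZ// sqrtrM// addr_ge0 ?sqr_ge0. Qed.

(** Parallelogram identity: pointwise, the two sides differ by the squared modulus of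
    [f x - g x]. *)
Lemma normsqD_le f g : L2 f -> L2 g ->
  normsq (fun x => f x + g x) <= 2 * normsq f + 2 * normsq g.
Proof.
move=> fL gL; have fi := L2_sqmod fL; have gi := L2_sqmod gL.
have fi2 : mu.-integrable setT (EFin \o fun x => 2 * sqmod f x).
  exact: (integrableZl measurableT 2 fi).
have gi2 : mu.-integrable setT (EFin \o fun x => 2 * sqmod g x).
  exact: (integrableZl measurableT 2 gi).
rewrite /normsq -(RintegralZl 2 measurableT fi) -(RintegralZl 2 measurableT gi).
rewrite -RintegralD//; apply: le_Rintegral => //.
- exact: L2_sqmod (L2D fL gL).
- exact: (integrableD measurableT fi2 gi2).
move=> x _; rewrite /sqmod !reimE -subr_ge0.
rewrite (_ : _ - _ = (Re (f x) - Re (g x)) ^+ 2 + (Im (f x) - Im (g x)) ^+ 2).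
  by rewrite addr_ge0 ?sqr_ge0.
by ring.
Qed.

Lemma normsq0 : normsq (fun=> 0 : C) = 0.
Proof.
rewrite /normsq (_ : sqmod _ = cst 0) ?/Rintegral ?integral0//.
by apply/funext => x; rewrite /sqmod /= expr0n addr0.
Qed.

(** The number of terms is fixed while the coefficients tend to 0, so the factors 2 from
    [normsqD_le] accumulate only [n] times. Norm convergence of the series thereby becomes scalar
    convergence of each coefficient. *)
Lemma cvg_normsq_sum n (c : nat -> 'I_n -> C) (f : 'I_n -> R -> C) :
  (forall i, L2 (f i)) -> (forall i, (fun N => sqabs (c N i)) @ \oo --> (0 : R)) ->
  (fun N => normsq (fun x => \sum_(i < n) c N i * f i x)) @ \oo --> (0 : R).
Proof.
elim: n c f => [|n IHn] c f fL c0.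
  under eq_fun do under eq_fun do rewrite big_ord0.
  by under eq_fun do rewrite normsq0; exact: cvg_cst.
have h1 : (fun N => normsq (fun x => c N ord0 * f ord0 x)) @ \oo --> (0 : R).
  under eq_fun do rewrite normsqZ//.
  by rewrite -(mul0r (normsq (f ord0))); apply: cvgM; [exact: c0|exact: cvg_cst].
have h2 := IHn (fun N i => c N (lift ord0 i)) (fun i => f (lift ord0 i))
  (fun i => fL _) (fun i => c0 _).
have h3 : (fun N => 2 * normsq (fun x => c N ord0 * f ord0 x) +
    2 * normsq (fun x => \sum_(i < n) c N (lift ord0 i) * f (lift ord0 i) x))
    @ \oo --> (0 : R).
  rewrite -[X in _ --> X](addr0 (0 : R)) -{1 2}(mulr0 (2 : R)).
  by apply: cvgD; (apply: cvgM; [exact: cvg_cst|]).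
apply: (squeeze_cvgr _ (cvg_cst 0) h3); apply: nearW => N.
rewrite normsq_ge0 /=; under eq_fun do rewrite big_ord_recl.
apply: normsqD_le; first exact/L2Z/fL.
by apply: L2_sum => i; exact/L2Z/fL.
Qed.

(** The function has no zero on [[1, 2]], an interval of measure 1, which cannot lie in a null
    set. *)
Lemma xgauss_not_ae0 s : ~ aeeq (xgauss s) (fun=> 0).
Proof.
move=> [N [mN N0 sN]].
have sub : `[1, 2]%classic `<=` N.
  move=> x /=; rewrite in_itv/= => /andP[x1 x2]; apply: sN => /= /(congr1 Re) /= /eqP.
  by rewrite mulf_eq0 gt_eqF ?gt_eqF ?gaussian_gt0//; lra.
have : (mu `[1%R, 2%R]%classic <= mu N)%E by apply: le_measure; rewrite ?inE.
rewrite N0 lebesgue_measure_itv/= lte_fin ltr1n /= -EFinB lee_fin; lra.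
Qed.

Lemma norm2_gt0 f : L2 f -> ~ aeeq f (fun=> 0) -> 0 < norm2 f.
Proof.
move=> fL f0; rewrite norm2E sqrtr_gt0 lt_neqAle normsq_ge0 andbT eq_sym.
apply/eqP => n0; apply: f0.
have fi := L2_sqmod fL.
have : (\int[mu]_x `|(sqmod f x)%:E| = 0)%E.
  under eq_integral do rewrite gee0_abs ?lee_fin ?sqmod_ge0//.
  by rewrite -[LHS]fineK ?(integrable_fin_num measurableT fi)// -/(Rintegral _ _ _) [X in X%:E]n0.
move=> /ae_eq_integral_abs => /(_ measurableT (measurable_int _ fi)).
move=> [N [mN N0 sN]]; exists N; split => // x /= fx; apply: sN => /= H.
apply: fx; have /eqP : sqmod f x = 0 by case: (H I).
rewrite paddr_eq0 ?sqr_ge0// !sqrf_eq0 => /andP[/eqP r0 /eqP i0].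
exact: complexP.
Qed.

Lemma sqabs_imag (a : R) : sqabs (a%:C * 'i) = a ^+ 2.
Proof. by rewrite /sqabs !reimE /=; ring. Qed.

Lemma sqabs_imagN (a : R) : sqabs (- (a%:C * 'i)) = a ^+ 2.
Proof. by rewrite /sqabs; case: (a%:C * 'i) (sqabs_imag a) => u v; rewrite /sqabs/= !sqrrN. Qed.

Lemma gauss_genE (eps alpha : R) : 0 < eps ->
  gauss_gen eps alpha = xgauss (alpha / Num.sqrt eps).
Proof.
move=> e0; apply/funext => x; rewrite /gauss_gen /xgauss /gaussian.
congr ((_ * expR _)%:C); field; have := e0; rewrite -sqrtr_gt0; lra.
Qed.

(** The adjoint acts diagonally on combinations of its eigenvectors, so each power multiplies every
    coefficient by a power of its eigenvalue. *)
Lemma tstar_pow_sum n (a : 'I_n -> C) (s : 'I_n -> R) m : (forall i, 0 < s i) ->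
  tstar_pow m (fun x => \sum_(i < n) a i * xgauss (s i) x)
    (fun x => \sum_(i < n) ((s i)%:C * 'i) ^+ m * a i * xgauss (s i) x).
Proof.
move=> s0; elim: m => [|m IHm] /=.
  split; first by apply: L2_sum => i; apply: L2Z; exact: L2_xgauss.
  by apply: aeW => x; apply: eq_bigr => i _; rewrite expr0 mul1r.
exists (fun x => \sum_(i < n) ((s i)%:C * 'i) ^+ m * a i * xgauss (s i) x); split => //.
apply: tstar_rel_sum => i.
have := tstar_relZ (((s i)%:C * 'i) ^+ m * a i) (tstar_xgauss (s0 i)).
congr tstar_rel; apply/funext => x; rewrite exprS; ring.
Qed.

Lemma imag_pow_odd m : ('i : C) ^+ (2 * m).+1 = (-1) ^+ m * 'i.
Proof.
rewrite exprSr exprM; congr (_ ^+ _ * _); rewrite expr2.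
by apply: complexP; rewrite !reimE /=; ring.
Qed.

(** The alternating sign cancels the one in [i ^ (2m+1) = (-1)^m i], and the powers of [sqrt eps]
    cancel as well. What remains is [i] times a term of the artanh series. *)
Lemma Sstar_term (eps alpha : R) m : 0 < eps ->
  ((- 1) ^+ m / (2 * m).+1%:R * Num.sqrt eps ^+ (2 * m).+1)%:C *
    ((alpha / Num.sqrt eps)%:C * 'i) ^+ (2 * m).+1 =
  'i * (alpha ^+ (2 * m).+1 / (2 * m).+1%:R)%:C.
Proof.
move=> e0; have r0 : Num.sqrt eps != 0 by rewrite gt_eqF// sqrtr_gt0.
rewrite exprMn imag_pow_odd -rmorphXn /=.
rewrite (_ : (-1) ^+ m = ((-1) ^+ m)%:C :> C); last by rewrite rmorphXn rmorphN1.
rewrite !mulrA -!rmorphM /= mulrC; congr (_ * _%:C).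
have -> : (alpha / Num.sqrt eps) ^+ (2 * m).+1 =
          alpha ^+ (2 * m).+1 / Num.sqrt eps ^+ (2 * m).+1 by rewrite expr_div_n.
(* Here [t] stands for the sign, [w] for [1 / (2m+1)], and [p], [q] for the odd powers of [sqrt eps]
   and [alpha]. *)
have cancel (t w p q : R) : t * t = 1 -> p != 0 -> t * w * p * (q / p) * t = q * w.
  by move=> tt p0; rewrite -[RHS]mul1r -tt; field.
by apply: cancel; rewrite ?expf_neq0// -expr2 sqrr_sign.
Qed.

(** Exchanging the two finite sums shows that the error after [N] has coefficients [a i * 'i *
    (artanh_sum N (alpha i) - L i)], which tend to 0. Leaving the limits [L] free lets one statement
    give both the domain inclusion and, for a single term, the eigenvalue equation. *)
Lemma Sstar_sum (eps : R) n (a : 'I_n -> C) (alpha L : 'I_n -> R) : 0 < eps ->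
  (forall i, 0 < alpha i) ->
  (forall i, (fun N => artanh_sum N (alpha i)) @ \oo --> L i) ->
  Sstar_rel eps (fun x => \sum_(i < n) a i * gauss_gen eps (alpha i) x)
    (fun x => - ((Num.sqrt eps)^-1)%:C *
      \sum_(i < n) a i * 'i * (L i)%:C * gauss_gen eps (alpha i) x).
Proof.
move=> e0 a0 aL; pose s i := alpha i / Num.sqrt eps.
have s0 i : 0 < s i by rewrite divr_gt0// sqrtr_gt0.
under eq_fun do under eq_bigr do rewrite gauss_genE//.
under [X in Sstar_rel _ _ X]eq_fun do under eq_bigr do rewrite gauss_genE//.
have xL i : L2 (xgauss (s i)) by exact: L2_xgauss.
split.
  split; first by apply: L2_sum => i; exact/L2Z/xL.
  apply: aeW => x; rewrite -sumrN; apply: eq_bigr => i _.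
  by rewrite /xgauss gaussianN mulNr rmorphN mulrN.
exists (fun m x => \sum_(i < n) ((s i)%:C * 'i) ^+ (2 * m).+1 * a i * xgauss (s i) x).
exists (fun x => \sum_(i < n) a i * 'i * (L i)%:C * xgauss (s i) x).
split; first by move=> m; exact: tstar_pow_sum.
split; first by apply: L2_sum => i; exact/L2Z/xL.
split => //.
rewrite (_ : (fun N => norm2 _) = fun N => Num.sqrt (normsq (fun x =>
    \sum_(i < n) (a i * 'i * (artanh_sum N (alpha i) - L i)%:C) * xgauss (s i) x))).
  rewrite -[X in _ --> X](@sqrtr0 R).
  apply: continuous_cvg; first exact: sqrt_continuous.
  apply: cvg_normsq_sum => // i.
  have -> : (fun N => sqabs (a i * 'i * (artanh_sum N (alpha i) - L i)%:C)) =
     fun N => sqabs (a i * 'i) * (artanh_sum N (alpha i) - L i) ^+ 2.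
    by apply/funext => N; rewrite /sqabs !reimE /=; ring.
  rewrite -(mulr0 (sqabs (a i * 'i))); apply: cvgM; first exact: cvg_cst.
  have h : (fun N => artanh_sum N (alpha i) - L i) @ \oo --> (0 : R).
    by rewrite -(subrr (L i)); apply: cvgB => //; exact: cvg_cst.
  by rewrite -[X in _ --> X](mulr0 (0 : R)); under eq_fun do rewrite expr2; exact: cvgM.
apply/funext => N; rewrite norm2E; congr (Num.sqrt (normsq _)); apply/funext => x.
under eq_bigr do rewrite mulr_sumr.
rewrite exchange_big -sumrB; apply: eq_bigr => i _.
rewrite rmorphB /= mulrBr mulrBl; congr (_ - _).
rewrite /artanh_sum rmorph_sum mulr_sumr mulr_suml; apply: eq_bigr => m _ /=.
by rewrite mulrA [in LHS]mulrA Sstar_term//; ring.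
Qed.

End Norm.

Theorem theorem3p4 (R : realType) (eps : R) (heps0 : 0 < eps) (heps1 : eps <= 1) :
  (* L_1 (finite complex linear combinations) is contained in D(S^*_eps) *)
  (forall (n : nat) (a : 'I_n -> complex R) (alpha : 'I_n -> R),
      (forall i, 0 < alpha i < 1) ->
      Sstar_dom eps (fun x => \sum_(i < n) a i * gauss_gen eps (alpha i) x)) /\
  (* every point of i(0,oo) is an eigenvalue of t^* *)
  (forall s : R, 0 < s ->
      exists f : R -> complex R, L2 f /\ ~ aeeq f (fun=> 0) /\
        tstar_rel f (fun x => (s%:C * 'i) * f x)) /\
  (* every point of -i(0,oo) is an eigenvalue of S^*_eps *)
  (forall s : R, 0 < s ->
      exists f : R -> complex R, L2 f /\ ~ aeeq f (fun=> 0) /\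
        Sstar_rel eps f (fun x => (- (s%:C * 'i)) * f x)) /\
  (* t^* is unbounded *)
  ~ (exists M : R, forall f h, tstar_rel f h -> norm2 h <= M * norm2 f) /\
  (* S^*_eps is unbounded *)
  ~ (exists M : R, forall f h, Sstar_rel eps f h -> norm2 h <= M * norm2 f).
Proof.
have r0 : 0 < Num.sqrt eps by rewrite sqrtr_gt0.
have t_eigen : forall s : R, 0 < s -> exists f : R -> complex R,
    L2 f /\ ~ aeeq f (fun=> 0) /\ tstar_rel f (fun x => (s%:C * 'i) * f x).
  move=> s s0; exists (xgauss s); split; first exact: L2_xgauss.
  by split; [exact: xgauss_not_ae0|exact: tstar_xgauss].
have S_eigen : forall s : R, 0 < s -> exists f : R -> complex R,
    L2 f /\ ~ aeeq f (fun=> 0) /\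
    Sstar_rel eps f (fun x => (- (s%:C * 'i)) * f x).
  (* The target value of artanh is [sqrt eps * s], so that the prefactor [- 1 / sqrt eps] turns
     [i * artanh alpha] into [- i s]. *)
  move=> s s0; have [alpha a01 aE] := artanh_surj (mulr_gt0 r0 s0).
  have a0 : 0 < alpha by case/andP: a01.
  exists (gauss_gen eps alpha); rewrite gauss_genE//.
  split; first by apply: L2_xgauss; rewrite divr_gt0.
  split; first exact: xgauss_not_ae0.
  have := @Sstar_sum R eps 1 (fun=> 1) (fun=> alpha) (fun=> Num.sqrt eps * s) heps0
    (fun=> a0).
  rewrite -{1}aE => /(_ (fun=> cvg_artanh_sum a01)).
  congr Sstar_rel; apply/funext => x; rewrite big_ord1 gauss_genE// ?mul1r//.
  rewrite -[in RHS](mulKf (lt0r_neq0 r0) s) [in RHS]rmorphM /=; ring.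
split; [|split; [exact: t_eigen|split; [exact: S_eigen|split]]].
(* The limits stay open until [cvg_artanh_sum] fixes them. *)
- move=> n a alpha a01; eexists; apply: Sstar_sum => // i.
    by case/andP: (a01 i).
  exact: cvg_artanh_sum.
(* An eigenvalue of modulus [|M| + 1] exceeds the supposed bound; the absolute value keeps it
   positive even for negative [M]. Dividing by the positive norm of the eigenvector gives the
   contradiction. *)
- move=> [M HM]; have [f [fL [f0 ff]]] := t_eigen (`|M| + 1) (ltr_wpDl (normr_ge0 M) ltr01).
  have := HM _ _ ff; rewrite norm2Z// sqabs_imag sqrtr_sqr ler_pM2r ?norm2_gt0//.
  have := ler_norm M; have := ler_norm (`|M| + 1); lra.
- move=> [M HM]; have [f [fL [f0 ff]]] := S_eigen (`|M| + 1) (ltr_wpDl (normr_ge0 M) ltr01).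
  have := HM _ _ ff; rewrite norm2Z// sqabs_imagN sqrtr_sqr ler_pM2r ?norm2_gt0//.
  have := ler_norm M; have := ler_norm (`|M| + 1); lra.
Qed.
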